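(* Let $\Psi=\{\psi_i\}_{i\in I}$ be a lower frame sequence in a separable Hilbert space $\mathcal{H}$ with canonical dual $\widetilde\Psi=\{\widetilde\psi_i\}$. Then the pseudo-inverse of the closed operator $\overline{D^r_\Psi}$ is given by $$\overline{D^r_\Psi}^{\dagger}f=\{\langle f,\widetilde\psi_i\rangle\}_{i\in I}\qquad(f\in\mathcal{H}_\Psi).$$ In particular, if $D_\Psi$ is closable, then $\overline{D_\Psi}^{\dagger}f=\{\langle f,\widetilde\psi_i\rangle\}_{i\in I}$.
   Context: $I$ is countable. $D_\Psi c=\sum_ic_i\psi_i$ on $\{c\in\ell^2:\sum_ic_i\psi_i\text{ converges in }\mathcal{H}\}$. $\mathcal{D}(C_\Psi)=\{f\in\mathcal{H}:\{\langle f,\psi_i\rangle\}_i\in\ell^2\}$, $\mathcal{H}_\Psi:=\overline{\mathcal{D}(C_\Psi)}$, $\pi_{\mathcal{H}_\Psi}$ the orthogonal projection onto $\mathcal{H}_\Psi$. $\Psi$ is a lower frame sequence if there is $A>0$ with $A\|f\|^2\le\sum_i|\langle f,\psi_i\rangle|^2$ for all $f\in\mathcal{D}(C_\Psi)$. $D^r_\Psi:\ell^2\supseteq\mathcal{D}(D^r_\Psi)\to\mathcal{H}_\Psi$, $D^r_\Psi c=\sum_ic_i\pi_{\mathcal{H}_\Psi}\psi_i$ on the set of $c\in\ell^2$ for which this converges; it is densely defined and closable with closure $\overline{D^r_\Psi}$. With $C^r_\Psi:\mathcal{D}(C_\Psi)\subseteq\mathcal{H}_\Psi\to\ell^2$,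 $C^r_\Psi f=\{\langle f,\psi_i\rangle\}$, the generalized frame operator is $\Gamma_\Psi=(C^r_\Psi)^*C^r_\Psi$ (bijective onto $\mathcal{H}_\Psi$ with bounded inverse when $\Psi$ is a lower frame sequence), and $\widetilde\psi_i:=\Gamma_\Psi^{-1}\pi_{\mathcal{H}_\Psi}\psi_i$. For a closed densely defined operator $T:\mathcal{D}(T)\subseteq\mathcal{K}_1\to\mathcal{K}_2$ the pseudo-inverse $T^\dagger$ is the unique operator from $\mathcal{K}_2$ to $\mathcal{K}_1$ with $\overline{\mathcal{R}(T^\dagger)}=\ker(T)^\perp$, $\ker(T^\dagger)=\mathcal{R}(T)^\perp$ and $TT^\dagger T=T$. *)

(* Defs.v *)
(* abstract complex Hilbert spaces set up by hand
   (MathComp-Analysis has no inner-product/Hilbert space theory). *)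
From HB Require Import structures.
From mathcomp Require Import all_boot all_order all_algebra.
From mathcomp Require Import reals complex.
Set Implicit Arguments. Unset Strict Implicit. Unset Printing Implicit Defensive.
Import Order.TTheory GRing.Theory Num.Theory.
Local Open Scope ring_scope.

Section Defs.
Variable C : numClosedFieldType.

(** Unconditional summation of a family indexed by a countable type,
    w.r.t. a squared norm [n2]: for every e > 0 there is a finite set s0 of
    indices such that every finite s containing s0 has partial sum e-close to l. *)
Definition has_sum (I : countType) (X : zmodType) (n2 : X -> C)
    (a : I -> X) (l : X) : Prop :=
  forall e : C, 0 < e -> exists s0 : seq I, forall s : seq I,
    uniq s -> {subset s0 <= s} -> n2 (\sum_(i <- s) a i - l) < e.

Definition csq (z : C) : C := `|z| ^+ 2.

(** ℓ²(I) : families with bounded finite partial sums of |c_i|^2 *)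
Definition l2 (I : countType) (c : I -> C) : Prop :=
  exists M : C, forall s : seq I, uniq s -> \sum_(i <- s) csq (c i) <= M.

(** ℓ² inner product relation: <c, d> = z *)
Definition l2ip (I : countType) (c d : I -> C) (z : C) : Prop :=
  has_sum csq (fun i => c i * (d i)^*) z.

(** ‖c - d‖²_{ℓ²} <= e *)
Definition l2dist_le (I : countType) (c d : I -> C) (e : C) : Prop :=
  forall s : seq I, uniq s -> \sum_(i <- s) csq (c i - d i) <= e.

Definition l2conv (I : countType) (cs : nat -> I -> C) (c : I -> C) : Prop :=
  forall e : C, 0 < e -> exists N, forall n, (N <= n)%N -> l2dist_le (cs n) c e.

Variable H : lmodType C.
Variable ip : H -> H -> C.

Definition hconv (u : nat -> H) (l : H) : Prop :=
  forall e : C, 0 < e -> exists N, forall n, (N <= n)%N ->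
    ip (u n - l) (u n - l) < e.

(** complex separable Hilbert space *)
Definition hilbert_space : Prop :=
  [/\ (forall a x y z, ip (a *: x + y) z = a * ip x z + ip y z),
      (forall x y, ip y x = (ip x y)^*),
      (forall x, 0 <= ip x x),
      (forall x, ip x x = 0 -> x = 0) &
      (forall u : nat -> H,
         (forall e : C, 0 < e -> exists N, forall m n, (N <= m)%N -> (N <= n)%N ->
              ip (u m - u n) (u m - u n) < e) ->
         exists l, hconv u l)].

Definition separable : Prop :=
  exists d : nat -> H, forall x (e : C), 0 < e ->
    exists n, ip (x - d n) (x - d n) < e.

(** closure of a subset of H *)
Definition hclosure (S : H -> Prop) (x : H) : Prop :=
  forall e : C, 0 < e -> exists y, S y /\ ip (x - y) (x - y) < e.

(** P is the orthogonal projection onto the (closed) subspace M *)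
Definition orth_proj (M : H -> Prop) (P : H -> H) : Prop :=
  forall x, M (P x) /\ forall y, M y -> ip (x - P x) y = 0.

Variable I : countType.
Variable psi : I -> H.

(** D(C_Psi) *)
Definition Cdom (f : H) : Prop := l2 (fun i => ip f (psi i)).

(** H_Psi *)
Definition HPsi : H -> Prop := hclosure Cdom.

Definition lower_frame_seq : Prop :=
  exists A : C, 0 < A /\ forall f, Cdom f -> forall M : C,
    (forall s : seq I, uniq s -> \sum_(i <- s) csq (ip f (psi i)) <= M) ->
    A * ip f f <= M.

(** Operators from ℓ²(I) to H, and from H to ℓ²(I), are given by their graphs. *)
Definition opLH := (I -> C) -> H -> Prop.
Definition opHL := H -> (I -> C) -> Prop.

(** synthesis operator D_Psi *)
Definition D_Psi : opLH := fun c h =>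
  l2 c /\ has_sum (fun x => ip x x) (fun i => c i *: psi i) h.

(** D^r_Psi (P is the orthogonal projection onto H_Psi) *)
Definition Dr_Psi (P : H -> H) : opLH := fun c h =>
  l2 c /\ has_sum (fun x => ip x x) (fun i => c i *: P (psi i)) h.

(** closure of (the graph of) an operator ℓ² -> H *)
Definition op_closure (T : opLH) : opLH := fun c h =>
  exists (cs : nat -> I -> C) (hs : nat -> H),
    (forall n, T (cs n) (hs n)) /\ l2conv cs c /\ hconv hs h.

Definition closable (T : opLH) : Prop :=
  forall c h1 h2, op_closure T c h1 -> op_closure T c h2 -> h1 = h2.

(** adjoint of C^r_Psi : D(C_Psi) ⊆ H_Psi -> ℓ², as an operator ℓ² -> H_Psi *)
Definition Cr_adj : opLH := fun c h =>
  l2 c /\ HPsi h /\ forall g, Cdom g ->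
    has_sum csq (fun i => ip g (psi i) * (c i)^*) (ip g h).

(** generalized frame operator Γ_Psi = (C^r_Psi)^* C^r_Psi *)
Definition Gamma_Psi (f h : H) : Prop :=
  Cdom f /\ Cr_adj (fun i => ip f (psi i)) h.

(** S is the pseudo-inverse of T : ℓ² ⊇ D(T) -> K, K = M ⊆ H a closed subspace:
    S is a linear operator from K to ℓ², closure R(S) = ker(T)^⊥,
    ker(S) = R(T)^⊥ (in K) and T S T = T. *)
Definition pseudo_inverse (M : H -> Prop) (T : opLH) (S : opHL) : Prop :=
  [/\ (forall f c, S f c -> M f /\ l2 c),
      (forall f c1 c2, S f c1 -> S f c2 -> c1 = c2) /\
      (forall a f1 f2 c1 c2, S f1 c1 -> S f2 c2 ->
          S (a *: f1 + f2) (fun i => a * c1 i + c2 i)),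
      (forall c, l2 c ->
         ((forall e : C, 0 < e -> exists f c', S f c' /\ l2dist_le c c' e) <->
          (forall d, T d 0 -> l2ip c d 0))),
      (forall f, S f (fun _ => 0) <-> (M f /\ forall c h, T c h -> ip f h = 0)) &
      (forall c h, T c h <-> exists h' c', [/\ T c h', S h' c' & T c' h])].

End Defs.

(* Main.v *)
(* Put phi_i = P psi_i and let T be the closure of D^r and C the analysis map.  For eps > 0 the
   finite systems eps g + sum_(i in s) <g, phi_i> phi_i = f are solvable, and their solutions
   converge along s, because <f, g_s> decreases and its decrements are
   eps |g_s - g_t|^2 + |c_s - c_t|^2; this gives g with T (C g) = f - eps g.
   The lower frame bound lets eps tend to 0, so every f in H_Psi is T (C g) for some g.
   Since T is contained in the adjoint of C, this g satisfies <f, psit_i> = <g, psi_i>, so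
   f |-> C g is the candidate pseudo-inverse and T C Gamma^-1 = id; the Penrose-type
   conditions follow by orthogonality.  If D_Psi is closable then D(C_Psi) is dense, so P = id. *)
Require Import Defs.
From HB Require Import structures.
From mathcomp Require Import all_boot all_order all_algebra.
From mathcomp Require Import reals complex.
From mathcomp Require Import boolp classical_sets ring lra.
Import Order.TTheory GRing.Theory Num.Theory.
Local Open Scope ring_scope.
Local Open Scope complex_scope.

Set Implicit Arguments. Unset Strict Implicit. Unset Printing Implicit Defensive.

Local Notation Re := (@complex.Re _).
Local Notation Im := (@complex.Im _).

(** * Squared moduli of complex numbers as real numbers *)

Section SquaredModulus.
Variable R : realType.
Implicit Types z w : R[i].

(** A real-valued [csq]: estimates run in [R], where the order is total and linear arithmetic
    applies. *)
Definition sqmod z : R := Re z ^+ 2 + Im z ^+ 2.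

Lemma csqE z : csq z = (sqmod z)%:C.
Proof. by rewrite /csq add_Re2_Im2. Qed.

Lemma sqmod_ge0 z : 0 <= sqmod z.
Proof. by rewrite addr_ge0 ?sqr_ge0. Qed.

Lemma sqmod0 : sqmod 0 = 0.
Proof. by rewrite /sqmod /= expr0n addr0. Qed.

Lemma sqmod_eq0 z : sqmod z = 0 -> z = 0.
Proof.
case: z => a b; rewrite /sqmod /= => h.
have /eqP := h; rewrite paddr_eq0 ?sqr_ge0 // !sqrf_eq0.
by case/andP => /eqP -> /eqP ->.
Qed.

Lemma sqmodN z : sqmod (- z) = sqmod z.
Proof. by case: z => a b; rewrite /sqmod /= !sqrrN. Qed.

Lemma sqmodJ z : sqmod (z^*)%R = sqmod z.
Proof. by case: z => a b; rewrite /sqmod /= sqrrN. Qed.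

Lemma sqmodM z w : sqmod (z * w) = sqmod z * sqmod w.
Proof. case: z w => a b [c d]; rewrite /sqmod /=; ring. Qed.

(** By the parallelogram law the gap is [sqmod (z - w)]. The bound stands in for the triangle
    inequality and avoids square roots; its factor 2 is why two errors are later taken below
    [r / 4]. *)
Lemma sqmodD z w : sqmod (z + w) <= 2 * (sqmod z + sqmod w).
Proof.
case: z w => a b [c d]; rewrite /sqmod /= -subr_ge0.
have -> : 2 * (a ^+ 2 + b ^+ 2 + (c ^+ 2 + d ^+ 2)) -
  ((a + c) ^+ 2 + (b + d) ^+ 2) = (a - c) ^+ 2 + (b - d) ^+ 2 by ring.
by rewrite addr_ge0 ?sqr_ge0.
Qed.

Lemma sqmodr (r : R) : sqmod r%:C = r ^+ 2.
Proof. by rewrite /sqmod /= expr0n addr0. Qed.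

Lemma Re_sqr_le_sqmod z : Re z ^+ 2 <= sqmod z.
Proof. by rewrite lerDl sqr_ge0. Qed.

Lemma sqmodB_expand z w :
  sqmod (z - w) = sqmod z + sqmod w - 2 * Re (z * (w^*)%R).
Proof. case: z w => a b [c d]; rewrite /sqmod /=; ring. Qed.

Lemma mulJ_sqmod z : z * (z^*)%R = (sqmod z)%:C.
Proof. by rewrite -csqE /csq normCK. Qed.

Lemma conjCr (r : R) : ((r%:C)^*)%R = r%:C.
Proof. exact: conjc_real. Qed.

Lemma RealC_gt0 (e : R[i]) : 0 < e -> exists2 r : R, 0 < r & e = r%:C.
Proof.
case: e => a b; rewrite ltcE /= => /andP[/eqP -> ha]; by exists a.
Qed.

Lemma Re_sum (J : Type) (s : seq J) (p : pred J) (F : J -> R[i]) :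
  Re (\sum_(i <- s | p i) F i) = \sum_(i <- s | p i) Re (F i).
Proof. by elim/big_rec2: _ => // i x y _ <-; case: (F i) y => ? ? []. Qed.

(* Cauchy-Schwarz, read off the nonnegative quadratic [X - 2 Re (l^* z) + |l|^2 Y] in [l]. *)
Lemma sqmod_le_of_form (X Y : R) z : 0 <= Y ->
  (forall l : R[i], 0 <= X - 2 * Re (l^* * z)%R + sqmod l * Y) ->
  sqmod z <= X * Y.
Proof.
move=> Y0 h.
(* Taking [l = t z] with [t] real makes the cross term real and leaves a real quadratic in [t]. *)
have key (t : R) : 0 <= X - 2 * t * sqmod z + t ^+ 2 * sqmod z * Y.
  have := h (t%:C * z); rewrite sqmodM sqmodr.
  suff -> : Re ((t%:C * z)^* * z)%R = t * sqmod z by rewrite mulrA.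
  by case: z {h} => a b; rewrite /sqmod /=; ring.
have z0 := sqmod_ge0 z.
have [Y1|Y1] := eqVneq Y 0.
  rewrite Y1 mulr0.
  have [->//|zn] := eqVneq (sqmod z) 0.
  (* For [Y = 0] the form is affine in [t], and this [t] gives it the value -1. *)
  have := key ((X + 1) / (2 * sqmod z)); rewrite Y1 mulr0 addr0.
  have -> : 2 * ((X + 1) / (2 * sqmod z)) * sqmod z = X + 1 by field.
  by move=> h1; lra.
have Yp : 0 < Y by rewrite lt0r Y1.
(* The quadratic is smallest at [t = 1 / Y]. *)
have := key Y^-1.
have -> : X - 2 * Y^-1 * sqmod z + Y^-1 ^+ 2 * sqmod z * Y = (X * Y - sqmod z) / Y by field.
by rewrite pmulr_lge0 ?invr_gt0 // subr_ge0.
Qed.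

End SquaredModulus.

(** * Finite sums over nested index lists *)

Section FiniteSums.
Variables (R : realType) (I : eqType).
Implicit Types (s t : seq I) (b : I -> R).

(** Extension by zero puts sums over nested lists on one index list, where they compare term by
    term. *)
Lemma sum_mem_subset (V : nmodType) s t (F : I -> V) :
  uniq s -> uniq t -> {subset s <= t} ->
  \sum_(i <- t) (if i \in s then F i else 0) = \sum_(i <- s) F i.
Proof.
move=> us ut st; rewrite -big_mkcond -big_filter; apply: perm_big.
apply: uniq_perm; rewrite ?filter_uniq // => i.
by rewrite mem_filter andb_idr //; exact: st.
Qed.

Lemma ler_sum_subset s t b : uniq s -> uniq t -> {subset s <= t} ->
  (forall i, 0 <= b i) -> \sum_(i <- s) b i <= \sum_(i <- t) b i.
Proof.
move=> us ut st b0; rewrite -(sum_mem_subset b us ut st).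
by apply: ler_sum => i _; case: ifP.
Qed.

Lemma ler_sum_support s t b : uniq s -> uniq t ->
  (forall i, 0 <= b i) -> (forall i, i \notin t -> b i = 0) ->
  \sum_(i <- s) b i <= \sum_(i <- t) b i.
Proof.
move=> us ut b0 bt.
rewrite (bigID (fun i => i \in t)) /= [X in _ + X]big1 ?addr0; last by move=> i /bt.
rewrite -big_filter; apply: ler_sum_subset; rewrite ?filter_uniq // => i.
by rewrite mem_filter => /andP[].
Qed.

End FiniteSums.

(** * Exhaustion of a countable type by finite sets *)

Section CountableExhaustion.
Variable I : countType.

(** The indices with code below [k]. These finite sets increase to [I], so sequences in [k] can
    replace the net of all finite subsets. *)
Definition initial (k : nat) : seq I := pmap (@pickle_inv I) (iota 0 k).

Lemma initial_uniq k : uniq (initial k).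
Proof. by apply: (pmap_uniq (@pickle_invK I)); exact: iota_uniq. Qed.

Lemma mem_initial k i : (i \in initial k) = (pickle i < k)%N.
Proof.
rewrite mem_pmap; apply/mapP/idP => [[n]|h].
  rewrite mem_iota add0n /= => nk h.
  by have := @pickle_invK I n; rewrite -h /= => ->.
by exists (pickle i); rewrite ?mem_iota ?pickleK_inv.
Qed.

Lemma sub_initial j k : (j <= k)%N -> {subset initial j <= initial k}.
Proof. by move=> jk i; rewrite !mem_initial => /leq_trans; apply. Qed.

Lemma initial_exhausts (s : seq I) : exists N, {subset s <= initial N}.
Proof.
exists (\max_(i <- s) (pickle i).+1)%N => i is_; rewrite mem_initial.
by rewrite (big_rem i is_) /= leq_max ltnS leqnn.
Qed.

End CountableExhaustion.

(** [N] is chosen with [E N] within [r] of the infimum of [E], below which no later value drops. *)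
Lemma nonincreasing_Cauchy (R : realType) (E : nat -> R) :
  (forall k, 0 <= E k) -> (forall j k, (j <= k)%N -> E k <= E j) ->
  forall r, 0 < r -> exists N, forall k, (N <= k)%N -> E N - E k < r.
Proof.
move=> E0 Emono r r0.
have lb : lbound (range E) 0 by move=> _ [k _ <-].
have hi : has_inf (range E) by split; [exists (E 0%N), 0%N | exists 0].
have [_ [N _ <-] hN] := inf_adherent r0 hi.
exists N => k Nk; have := ge_inf hi.2 (imageP E (I : setT k)).
by move: hN; lra.
Qed.

Lemma invS_lt (R : realType) (r : R) : 0 < r ->
  exists N, forall n, (N <= n)%N -> n.+1%:R^-1 < r.
Proof.
move=> r0; exists (Num.bound r^-1) => n Nn.
rewrite invf_plt ?posrE ?ltr0Sn //.
apply: lt_le_trans (archi_boundP _) _; first by rewrite invr_ge0 ltW.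
by rewrite ler_nat; apply: leq_trans Nn _.
Qed.

(** * Unconditional sums, for scalars and vectors at once *)

Section QuadraticSums.
Variables (R : realType) (I : countType) (X : zmodType).
Variables (n2 : X -> R[i]) (m : X -> R).
Hypothesis n2E : forall x, n2 x = (m x)%:C.

Lemma has_sumP (a : I -> X) l : has_sum n2 a l <->
  forall r : R, 0 < r -> exists s0 : seq I, forall s : seq I,
    uniq s -> {subset s0 <= s} -> m (\sum_(i <- s) a i - l) < r.
Proof.
split=> h r r0.
  have [|s0 hs] := h r%:C; first by rewrite ltcR.
  by exists s0 => s us ss; have := hs s us ss; rewrite n2E ltcR.
have [q q0 ->] := RealC_gt0 r0; have [s0 hs] := h q q0.
by exists s0 => s us ss; rewrite n2E ltcR hs.
Qed.

Lemma has_sum_finite (a : I -> X) (s0 : seq I) : m 0 = 0 -> uniq s0 ->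
  (forall i, i \notin s0 -> a i = 0) -> has_sum n2 a (\sum_(i <- s0) a i).
Proof.
move=> m0 us0 h; apply/has_sumP => r r0; exists s0 => s us ss.
suff -> : \sum_(i <- s) a i = \sum_(i <- s0) a i by rewrite subrr m0.
rewrite -(sum_mem_subset a us0 us ss); apply: eq_bigr => i _.
by case: ifP => // /negbT /h.
Qed.

Hypothesis mD : forall x y, m (x + y) <= 2 * (m x + m y).
Hypothesis mN : forall x, m (- x) = m x.

Lemma has_sumB (a b : I -> X) k l :
  has_sum n2 a k -> has_sum n2 b l -> has_sum n2 (fun i => a i - b i) (k - l).
Proof.
move=> /has_sumP ha /has_sumP hb; apply/has_sumP => r r0.
have r4 : 0 < r / 4 by lra.
have [s1 h1] := ha _ r4; have [s2 h2] := hb _ r4.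
exists (s1 ++ s2) => s us ss.
have k1 := h1 s us (fun i hi => ss i (ltac:(by rewrite mem_cat hi))).
have k2 := h2 s us (fun i hi => ss i (ltac:(by rewrite mem_cat hi orbT))).
rewrite sumrB.
have -> : \sum_(i <- s) a i - \sum_(i <- s) b i - (k - l) =
  (\sum_(i <- s) a i - k) + - (\sum_(i <- s) b i - l).
  by rewrite !opprB addrACA [RHS]addrACA; congr (_ + _); rewrite addrC.
by apply: le_lt_trans (mD _ _) _; rewrite mN; lra.
Qed.

(** The difference of the two sums is a sum of the zero family; the tolerance [m (k - l)] then
    excludes [k - l] being nonzero. *)
Lemma has_sum_unique (a : I -> X) k l : (forall x, 0 <= m x) ->
  (forall x, m x = 0 -> x = 0) ->
  has_sum n2 a k -> has_sum n2 a l -> k = l.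
Proof.
move=> m0 mx ha hb; have /has_sumP h := has_sumB ha hb.
apply/eqP; rewrite -subr_eq0; apply/eqP/mx/eqP/negPn/negP => n0.
have mp : 0 < m (k - l) by rewrite lt0r n0 m0.
have [s0 /(_ (undup s0) (undup_uniq _)) hs] := h _ mp.
have := hs (fun i hi => (ltac:(by rewrite mem_undup))).
rewrite big1 ?sub0r ?mN ?ltxx // => i _; exact: subrr.
Qed.

End QuadraticSums.

(** * Square-summable families *)

Section SquareSummable.
Variables (R : realType) (I : countType).
Implicit Types c d : I -> R[i].

Lemma csq_sumE c (s : seq I) :
  \sum_(i <- s) csq (c i) = (\sum_(i <- s) sqmod (c i))%:C.
Proof. by rewrite rmorph_sum; apply: eq_bigr => i _; exact: csqE. Qed.

Lemma l2P c : l2 c <->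
  exists M : R, forall s : seq I, uniq s -> \sum_(i <- s) sqmod (c i) <= M.
Proof.
split=> [[M h]|[M h]]; last first.
  by exists M%:C => s us; rewrite csq_sumE lecR h.
(* Comparable elements of [R[i]] have equal imaginary parts, so the real part of the bound is again
   a bound. *)
exists (Re M) => s us; have := h s us; rewrite csq_sumE lecE /=.
by case/andP.
Qed.

Lemma l2dist_leP c d (r : R) : l2dist_le c d r%:C <->
  forall s : seq I, uniq s -> \sum_(i <- s) sqmod (c i - d i) <= r.
Proof. by split=> h s /h; rewrite (csq_sumE (fun i => c i - d i)) lecR. Qed.

Lemma l2_finite c (s : seq I) : uniq s ->
  (forall i, i \notin s -> c i = 0) -> l2 c.
Proof.
move=> us h; apply/l2P; exists (\sum_(i <- s) sqmod (c i)) => t ut.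
by apply: ler_sum_support => // [i|i /h ->]; rewrite ?sqmod_ge0 ?sqmod0.
Qed.

Lemma l2_close c d (r : R) : l2 d -> l2dist_le d c r%:C -> l2 c.
Proof.
move=> /l2P [M hM] /l2dist_leP h; apply/l2P; exists (2 * (M + r)) => s us.
apply: (@le_trans _ _ (\sum_(i <- s) 2 * (sqmod (d i) + sqmod (d i - c i)))).
  apply: ler_sum => i _.
  rewrite -[c i in leLHS](subKr (d i)); apply: le_trans (sqmodD _ _) _.
  by rewrite sqmodN.
by rewrite -mulr_sumr big_split /=; have := hM s us; have := h s us; lra.
Qed.

(** The form required by [sqmod_le_of_form] is the sum of the terms [sqmod (c i - l * d i)]. *)
Lemma sum_CauchySchwarz c d (s : seq I) :
  sqmod (\sum_(i <- s) c i * ((d i)^*)%R) <=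
  (\sum_(i <- s) sqmod (c i)) * (\sum_(i <- s) sqmod (d i)).
Proof.
apply: sqmod_le_of_form => [|l]; first by apply: sumr_ge0 => i _; exact: sqmod_ge0.
have -> : \sum_(i <- s) sqmod (c i) -
    2 * Re ((l^*)%R * (\sum_(i <- s) c i * ((d i)^*)%R)) +
    sqmod l * (\sum_(i <- s) sqmod (d i)) =
    \sum_(i <- s) sqmod (c i - l * d i).
  rewrite mulr_sumr Re_sum mulr_sumr mulr_sumr -sumrB -big_split /=.
  apply: eq_bigr => i _; rewrite sqmodB_expand sqmodM rmorphM /=.
  by rewrite [in RHS]mulrCA [RHS]addrAC.
by apply: sumr_ge0 => i _; exact: sqmod_ge0.
Qed.

(** A Fatou-type argument: on a fixed finite [s], a late [cs k] is close to [c] pointwise, and the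
    Cauchy bound between [cs n] and [cs k] does not depend on [s]. *)
Lemma l2conv_of_Cauchy (cs : nat -> I -> R[i]) c :
  (forall r : R, 0 < r -> exists N, forall m n, (N <= m)%N -> (N <= n)%N ->
     l2dist_le (cs m) (cs n) r%:C) ->
  (forall i (r : R), 0 < r -> exists N, forall n, (N <= n)%N ->
     sqmod (cs n i - c i) < r) ->
  l2conv cs c.
Proof.
move=> hC hp e e0; have [r r0 ->] := RealC_gt0 e0.
have [|N hN] := hC (r / 4); first by lra.
exists N => n Nn; apply/l2dist_leP => s us.
have [K hK] : exists K, forall k, (K <= k)%N ->
    \sum_(i <- s) sqmod (cs k i - c i) <= r / 4.
  (* Each index of [s] receives an equal share of [r / 4]; the successor keeps the divisor nonzero
     for empty [s]. *)
  have d0 : 0 < r / 4 / (size s).+1%:R by rewrite divr_gt0 ?ltr0Sn //; lra.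
  have /choice [f hf] := fun i => hp i _ d0.
  exists (\max_(i <- s) f i)%N => k hk.
  apply: (@le_trans _ _ (\sum_(i <- s) (r / 4 / (size s).+1%:R))).
    rewrite big_seq [leRHS]big_seq; apply: ler_sum => i hi; apply/ltW/hf.
    by apply: leq_trans hk; rewrite (big_rem i hi) /= leq_maxl.
  rewrite big_const_seq count_predT iter_addr_0 -[leLHS]mulr_natr.
  rewrite -[leRHS](@divfK _ (size s).+1%:R) ?pnatr_eq0 //.
  by rewrite ler_wpM2l ?ler_nat // ltW.
pose k := maxn N K.
have h1 := hK k (leq_maxr _ _).
have /l2dist_leP /(_ s us) h2 := hN n k Nn (leq_maxl _ _).
apply: (@le_trans _ _ (\sum_(i <- s)
    2 * (sqmod (cs n i - cs k i) + sqmod (cs k i - c i)))).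
  apply: ler_sum => i _; apply: le_trans (sqmodD _ _).
  by rewrite addrA subrK.
by rewrite -mulr_sumr big_split /=; lra.
Qed.

Lemma l2dist_leC c d (e : R[i]) : l2dist_le c d e -> l2dist_le d c e.
Proof.
move=> h s us; have := h s us; congr (_ <= _); apply: eq_bigr => i _.
by rewrite /csq distrC.
Qed.

Lemma l2dist_le_trans c d d' (r r' : R) :
  l2dist_le c d r%:C -> l2dist_le d d' r'%:C -> l2dist_le c d' (2 * (r + r'))%:C.
Proof.
move=> /l2dist_leP h /l2dist_leP h'; apply/l2dist_leP => s us.
apply: (@le_trans _ _ (\sum_(i <- s) 2 * (sqmod (c i - d i) + sqmod (d i - d' i)))).
  apply: ler_sum => i _; apply: le_trans (sqmodD _ _).
  by rewrite addrA subrK.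
by rewrite -mulr_sumr big_split /=; have := h s us; have := h' s us; lra.
Qed.

Lemma l2dist_le_weaken c d (r r' : R) :
  r <= r' -> l2dist_le c d r%:C -> l2dist_le c d r'%:C.
Proof. by move=> rr h s us; apply: le_trans (h s us) _; rewrite lecR. Qed.

Lemma l2dist_leB c d c' d' (r r' : R) :
  l2dist_le c d r%:C -> l2dist_le c' d' r'%:C ->
  l2dist_le (fun i => c i - c' i) (fun i => d i - d' i) (2 * (r + r'))%:C.
Proof.
move=> /l2dist_leP h /l2dist_leP h'; apply/l2dist_leP => s us.
apply: (@le_trans _ _ (\sum_(i <- s) 2 * (sqmod (c i - d i) + sqmod (c' i - d' i)))).
  apply: ler_sum => i _; rewrite -[sqmod (c' i - _)]sqmodN.
  apply: le_trans (sqmodD _ _); rewrite le_eqVlt; apply/orP; left; apply/eqP.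
  by congr sqmod; ring.
by rewrite -mulr_sumr big_split /=; have := h s us; have := h' s us; lra.
Qed.

Lemma l2_lin (a : R[i]) c d : l2 c -> l2 d -> l2 (fun i => a * c i + d i).
Proof.
move=> /l2P [M hM] /l2P [M' hM']; apply/l2P.
exists (2 * (sqmod a * M + M')) => s us.
apply: (@le_trans _ _ (\sum_(i <- s) 2 * (sqmod a * sqmod (c i) + sqmod (d i)))).
  by apply: ler_sum => i _; rewrite -sqmodM; exact: sqmodD.
rewrite -mulr_sumr big_split /= -mulr_sumr ler_wpM2l ?lerD ?hM' //.
by rewrite ler_wpM2l ?sqmod_ge0 ?hM.
Qed.

(** The gaps [M - S k] are nonnegative and nonincreasing, hence Cauchy. Any finite [s] lies in some
    [initial I K], so its part outside [initial I N] weighs at most [S K - S N]. *)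
Lemma l2_truncation c (r : R) : l2 c -> 0 < r -> exists N,
  l2dist_le c (fun i => if i \in initial I N then c i else 0) r%:C.
Proof.
move=> /l2P [M hM] r0.
pose S k := \sum_(i <- initial I k) sqmod (c i).
have Smono j k : (j <= k)%N -> S j <= S k.
  move=> jk; apply: ler_sum_subset => [|||i]; rewrite ?initial_uniq ?sqmod_ge0 //.
  exact: sub_initial.
have S0 k : 0 <= M - S k by rewrite subr_ge0 hM ?initial_uniq.
have [|N hN] := nonincreasing_Cauchy S0 _ r0.
  by move=> j k jk; rewrite lerD2l lerN2 Smono.
exists N; apply/l2dist_leP => s us.
have [K0 hK0] := initial_exhausts s; pose K := maxn N K0.
have hK : {subset s <= initial I K}.
  by move=> i /hK0; apply: sub_initial; exact: leq_maxr.
apply: le_trans (ltW (hN K (leq_maxl _ _))).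
apply: (@le_trans _ _ (\sum_(i <- initial I K)
    sqmod (c i - (if i \in initial I N then c i else 0)))).
  by apply: ler_sum_subset => [|||i]; rewrite ?initial_uniq ?sqmod_ge0.
have -> : M - S N - (M - S K) = S K - S N by ring.
rewrite /S -(sum_mem_subset _ (initial_uniq I N) (initial_uniq I K)); last first.
  by apply: sub_initial; exact: leq_maxl.
rewrite -sumrB; apply: ler_sum => i _.
by case: ifP => _; rewrite ?subr0 // !subrr sqmod0.
Qed.

Lemma has_sum_conj (a : I -> R[i]) l : has_sum (@csq _) a l ->
  has_sum (@csq _) (fun i => ((a i)^*)%R) ((l^*)%R).
Proof.
move=> /(has_sumP (@csqE R)) h; apply/(has_sumP (@csqE R)) => r /h [s0 hs].
exists s0 => s us ss; rewrite -(rmorph_sum (Num.conj)) -rmorphB sqmodJ.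
exact: hs.
Qed.

Lemma csq_has_sumB (a b : I -> R[i]) k l :
  has_sum (@csq _) a k -> has_sum (@csq _) b l ->
  has_sum (@csq _) (fun i => a i - b i) (k - l).
Proof. exact: (has_sumB (@csqE R) (@sqmodD R) (@sqmodN R)). Qed.

Lemma csq_has_sum_unique (a : I -> R[i]) k l :
  has_sum (@csq _) a k -> has_sum (@csq _) a l -> k = l.
Proof.
exact: (has_sum_unique (@csqE R) (@sqmodD R) (@sqmodN R) (@sqmod_ge0 R) (@sqmod_eq0 R)).
Qed.

(** If a partial sum exceeded [Re z] by [r], so would every larger one, against convergence at
    tolerance [r ^+ 2]. This turns the adjoint relation into norm bounds. *)
Lemma l2ip_ge_partial c z : l2ip c c z ->
  forall s : seq I, uniq s -> \sum_(i <- s) sqmod (c i) <= Re z.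
Proof.
move=> /(has_sumP (@csqE R)) h s us; rewrite leNgt; apply/negP => hlt.
pose r := \sum_(i <- s) sqmod (c i) - Re z.
have r0 : 0 < r by rewrite subr_gt0.
have [|s0 hs] := h (r ^+ 2); first by rewrite exprn_gt0.
have ut := undup_uniq (s ++ s0).
have := hs _ ut (fun i hi => (ltac:(by rewrite mem_undup mem_cat hi orbT))).
apply/negP; rewrite -leNgt; apply: le_trans (Re_sqr_le_sqmod _).
under eq_bigr do rewrite mulJ_sqmod.
rewrite -rmorph_sum raddfB /=.
have : \sum_(i <- s) sqmod (c i) <= \sum_(i <- undup (s ++ s0)) sqmod (c i).
  apply: ler_sum_subset => // [i hi|i]; last exact: sqmod_ge0.
  by rewrite mem_undup mem_cat hi.
by move: r0; rewrite /r => r0 hle; rewrite ler_sqr ?nnegrE; lra.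
Qed.

(* [x + d] orthogonal to [d] gives [|d|^2 = - <x, d> <= (|x|^2 + |d|^2) / 2]. *)
Lemma orthogonal_contraction (x d : I -> R[i]) (r : R) :
  (forall s : seq I, uniq s -> \sum_(i <- s) sqmod (x i) <= r) ->
  l2ip (fun i => x i + d i) d 0 ->
  forall s : seq I, uniq s -> \sum_(i <- s) sqmod (d i) <= r.
Proof.
move=> hx /(has_sumP (@csqE R)) hxd s us; apply/ler_addgt0Pr => e e0.
(* This tolerance bounds the real part of the inner product of [x + d] and [d] by [e / 2]; that term
   enters twice in the final estimate. *)
have [|s0 hs] := hxd ((e / 2) ^+ 2); first by rewrite exprn_gt0 //; lra.
have ut := undup_uniq (s ++ s0).
have := hs _ ut (fun i hi => (ltac:(by rewrite mem_undup mem_cat hi orbT))).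
have := hx _ ut.
have : \sum_(i <- s) sqmod (d i) <= \sum_(i <- undup (s ++ s0)) sqmod (d i).
  apply: ler_sum_subset => // [i hi|i]; last exact: sqmod_ge0.
  by rewrite mem_undup mem_cat hi.
move: (undup _) => t h1 h2; rewrite subr0 => h3.
have h4 : Re (\sum_(i <- t) (x i + d i) * ((d i)^*)%R) < e / 2.
  rewrite ltNge; apply/negP => h; move: h3; apply/negP; rewrite -leNgt.
  by apply: le_trans (Re_sqr_le_sqmod _); rewrite ler_sqr ?nnegrE; lra.
have h5 : 0 <= \sum_(i <- t) sqmod (x i + d i).
  by apply: sumr_ge0 => i _; exact: sqmod_ge0.
have h6 : \sum_(i <- t) sqmod (x i + d i) = \sum_(i <- t) sqmod (x i)
    - \sum_(i <- t) sqmod (d i) + 2 * Re (\sum_(i <- t) (x i + d i) * ((d i)^*)%R).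
  rewrite Re_sum mulr_sumr -sumrB -big_split /=; apply: eq_bigr => i _.
  case: (x i) (d i) => a b [a' b']; rewrite /sqmod /=; ring.
by lra.
Qed.

End SquareSummable.

(** * Inner products and squared norms *)

Section HilbertSpace.
Variables (R : realType) (H : lmodType R[i]) (ip : H -> H -> R[i]).
Hypothesis hH : hilbert_space ip.
Implicit Types x y z : H.

Definition sqnorm x : R := Re (ip x x).

Lemma ipDl x y z : ip (x + y) z = ip x z + ip y z.
Proof. by have [h _ _ _ _] := hH; have := h 1 x y z; rewrite scale1r mul1r. Qed.

Lemma ip0l z : ip 0 z = 0.
Proof. by apply: (addrI (ip 0 z)); rewrite -ipDl !addr0. Qed.

Lemma ipZl a x z : ip (a *: x) z = a * ip x z.
Proof. by have [h _ _ _ _] := hH; have := h a x 0 z; rewrite ip0l !addr0. Qed.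

Lemma ipNl x z : ip (- x) z = - ip x z.
Proof. by rewrite -scaleN1r ipZl mulN1r. Qed.

Lemma ipBl x y z : ip (x - y) z = ip x z - ip y z.
Proof. by rewrite ipDl ipNl. Qed.

Lemma ipJ x y : ip y x = ((ip x y)^*)%R.
Proof. by have [_ h _ _ _] := hH. Qed.

Lemma ipDr x y z : ip z (x + y) = ip z x + ip z y.
Proof. by rewrite ipJ ipDl rmorphD /= -!ipJ. Qed.

Lemma ipNr x z : ip z (- x) = - ip z x.
Proof. by rewrite ipJ ipNl rmorphN /= -ipJ. Qed.

Lemma ipBr x y z : ip z (x - y) = ip z x - ip z y.
Proof. by rewrite ipDr ipNr. Qed.

Lemma ipZr a x z : ip z (a *: x) = (a^*)%R * ip z x.
Proof. by rewrite ipJ ipZl rmorphM /= -ipJ. Qed.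

Lemma ip0r z : ip z 0 = 0.
Proof. by rewrite ipJ ip0l rmorph0. Qed.

Lemma ip_suml (J : Type) (s : seq J) (F : J -> H) z :
  ip (\sum_(i <- s) F i) z = \sum_(i <- s) ip (F i) z.
Proof. by elim/big_rec2: _ => [|i x y _ <-]; rewrite ?ip0l ?ipDl. Qed.

Lemma ip_sumr (J : Type) (s : seq J) (F : J -> H) z :
  ip z (\sum_(i <- s) F i) = \sum_(i <- s) ip z (F i).
Proof. by elim/big_rec2: _ => [|i x y _ <-]; rewrite ?ip0r ?ipDr. Qed.

Lemma ip_sqnorm x : ip x x = (sqnorm x)%:C.
Proof.
have [_ _ h _ _] := hH; have := h x; rewrite /sqnorm; case: (ip x x) => a b.
by rewrite lecE /= => /andP[/eqP -> _].
Qed.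

Lemma sqnorm_ge0 x : 0 <= sqnorm x.
Proof. by have [_ _ h _ _] := hH; have := h x; rewrite ip_sqnorm ler0c. Qed.

Lemma sqnorm_eq0 x : sqnorm x = 0 -> x = 0.
Proof. by have [_ _ _ h _] := hH; move=> h0; apply: h; rewrite ip_sqnorm h0. Qed.

Lemma sqnorm0 : sqnorm 0 = 0.
Proof. by rewrite /sqnorm ip0l. Qed.

Lemma sqnormN x : sqnorm (- x) = sqnorm x.
Proof. by rewrite /sqnorm ipNl ipNr opprK. Qed.

Lemma sqnormBC x y : sqnorm (x - y) = sqnorm (y - x).
Proof. by rewrite -sqnormN opprB. Qed.

Lemma Re_ipC x y : Re (ip y x) = Re (ip x y).
Proof. by rewrite ipJ; case: (ip x y). Qed.

Lemma sqnormB_expand x y : sqnorm (x - y) = sqnorm x + sqnorm y - 2 * Re (ip x y).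
Proof.
rewrite /sqnorm ipBl !ipBr !raddfB /= (Re_ipC x y).
by ring.
Qed.

Lemma sqnormD x y : sqnorm (x + y) <= 2 * (sqnorm x + sqnorm y).
Proof.
have := sqnorm_ge0 (x - y); rewrite sqnormB_expand.
have := sqnormB_expand x (- y); rewrite opprK ipNr sqnormN raddfN /=; lra.
Qed.

Lemma sqnormZ a x : sqnorm (a *: x) = sqmod a * sqnorm x.
Proof.
rewrite {1}/sqnorm ipZl ipZr mulrA mulJ_sqmod ip_sqnorm.
by rewrite -rmorphM.
Qed.

Lemma ip_CauchySchwarz x y : sqmod (ip x y) <= sqnorm x * sqnorm y.
Proof.
apply: sqmod_le_of_form => [|l]; first exact: sqnorm_ge0.
rewrite -ipZr -sqnormZ.
by have := sqnorm_ge0 (x - l *: y); rewrite sqnormB_expand addrAC.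
Qed.

Lemma hconvP (u : nat -> H) l : hconv ip u l <->
  forall r : R, 0 < r -> exists N, forall n, (N <= n)%N -> sqnorm (u n - l) < r.
Proof.
split=> h r r0.
  have [|N hN] := h r%:C; first by rewrite ltcR.
  by exists N => n /hN; rewrite ip_sqnorm ltcR.
have [q q0 ->] := RealC_gt0 r0; have [N hN] := h q q0.
by exists N => n /hN; rewrite ip_sqnorm ltcR.
Qed.

Lemma hilbert_complete (u : nat -> H) :
  (forall r : R, 0 < r -> exists N, forall m n, (N <= m)%N -> (N <= n)%N ->
     sqnorm (u m - u n) < r) ->
  exists l, hconv ip u l.
Proof.
have [_ _ _ _ h] := hH; move=> hu; apply: h => e /RealC_gt0 [r r0 ->].
have [N hN] := hu r r0; exists N => m n Nm Nn.
by rewrite ip_sqnorm ltcR hN.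
Qed.

Lemma hclosureP (S : H -> Prop) x : hclosure ip S x <->
  forall r : R, 0 < r -> exists y, S y /\ sqnorm (x - y) < r.
Proof.
split=> h r r0.
  have [|y [Sy hy]] := h r%:C; first by rewrite ltcR.
  by exists y; move: hy; rewrite ip_sqnorm ltcR.
have [q q0 ->] := RealC_gt0 r0; have [y [Sy hy]] := h q q0.
by exists y; rewrite ip_sqnorm ltcR.
Qed.

(** By Pythagoras |x - y|^2 = |x|^2 + |y|^2 for [y] in [S], so no such [y] is within tolerance |x|^2
    of a nonzero [x]. *)
Lemma hclosure_orth (S : H -> Prop) x :
  hclosure ip S x -> (forall y, S y -> ip y x = 0) -> x = 0.
Proof.
move=> /hclosureP hx ho; apply/sqnorm_eq0/eqP/negPn/negP => n0.
have p0 : 0 < sqnorm x by rewrite lt0r n0 sqnorm_ge0.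
have [y [/ho yx]] := hx _ p0; rewrite sqnormB_expand Re_ipC yx /=.
by have := sqnorm_ge0 y; lra.
Qed.

Lemma ip_hconv (u : nat -> H) l z : hconv ip u l ->
  forall r : R, 0 < r -> exists N, forall n, (N <= n)%N ->
    sqmod (ip (u n) z - ip l z) < r.
Proof.
move=> /hconvP hu r r0; have z0 := sqnorm_ge0 z.
(* Adding 1 covers the case [z = 0]. *)
have d0 : 0 < r / (sqnorm z + 1) by rewrite divr_gt0 //; lra.
have [N hN] := hu _ d0; exists N => n /hN; rewrite ltr_pdivlMr; last by lra.
rewrite -ipBl; apply: le_lt_trans; apply: le_trans (ip_CauchySchwarz _ _) _.
by rewrite ler_wpM2l ?sqnorm_ge0 //; lra.
Qed.

End HilbertSpace.

(** * Closures of operator graphs *)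

Section ClosedOperators.
Variables (R : realType) (H : lmodType R[i]) (ip : H -> H -> R[i]) (I : countType).
Hypothesis hH : hilbert_space ip.
Local Notation sqnorm := (sqnorm ip).
Implicit Types (T : @opLH R[i] H I) (c : I -> R[i]).

(** Trades sequences for one approximation per tolerance; conversely, tolerances 1/(n+1) and choice
    rebuild the sequences. *)
Lemma op_closureP T c h : op_closure ip T c h <->
  forall r : R, 0 < r -> exists c' h',
    [/\ T c' h', l2dist_le c' c r%:C & sqnorm (h' - h) < r].
Proof.
split=> [[cs [hs [hT [hc /(hconvP hH) hh]]]] r r0|hr].
  have [|N hN] := hc r%:C; first by rewrite ltcR.
  have [K hK] := hh r r0; pose n := maxn N K.
  exists (cs n), (hs n); split=> //; first by apply: hN; exact: leq_maxl.
  by apply: hK; exact: leq_maxr.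
have /choice [f hf] : forall n, exists p : (I -> R[i]) * H,
   [/\ T p.1 p.2, l2dist_le p.1 c (n.+1%:R^-1)%:C & sqnorm (p.2 - h) < n.+1%:R^-1].
  move=> n; have [|c' [h' ?]] := hr n.+1%:R^-1; first by rewrite invr_gt0 ltr0Sn.
  by exists (c', h').
exists (fun n => (f n).1), (fun n => (f n).2); split; first by move=> n; case: (hf n).
split.
  move=> e /RealC_gt0 [r r0 ->]; have [N hN] := invS_lt r0; exists N => n Nn.
  by have [_ h1 _] := hf n; apply: l2dist_le_weaken h1; apply/ltW/hN.
apply/(hconvP hH) => r r0; have [N hN] := invS_lt r0; exists N => n Nn.
by have [_ _ h1] := hf n; apply: lt_trans h1 (hN _ Nn).
Qed.

(** Needed for limits of points that themselves lie only in the closure of the graph, as in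
    [frame_operator_onto]. *)
Lemma op_closure_closed T c h :
  (forall r : R, 0 < r -> exists c' h',
    [/\ op_closure ip T c' h', l2dist_le c' c r%:C & sqnorm (h' - h) < r]) ->
  op_closure ip T c h.
Proof.
move=> hr; apply/op_closureP => r r0; have r4 : 0 < r / 4 by lra.
have [c1 [h1 [/op_closureP /(_ _ r4) [c2 [h2 [T2 a2 b2]]] a1 b1]]] := hr _ r4.
exists c2, h2; split=> //.
  by apply: l2dist_le_weaken (l2dist_le_trans a2 a1); lra.
have -> : h2 - h = (h2 - h1) + (h1 - h) by rewrite addrA subrK.
by apply: le_lt_trans (sqnormD hH _ _) _; lra.
Qed.

Lemma op_closure_l2 T c h : (forall c' h', T c' h' -> l2 c') ->
  op_closure ip T c h -> l2 c.
Proof.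
move=> hT /op_closureP /(_ 1 ltr01) [c' [h' [/hT l2c' hd _]]].
exact: l2_close l2c' hd.
Qed.

Lemma op_closureB T c h c' h' :
  (forall c h c' h', T c h -> T c' h' -> T (fun i => c i - c' i) (h - h')) ->
  op_closure ip T c h -> op_closure ip T c' h' ->
  op_closure ip T (fun i => c i - c' i) (h - h').
Proof.
move=> hT /op_closureP h1 /op_closureP h2; apply/op_closureP => r r0.
have r4 : 0 < r / 4 by lra.
have [c1 [k1 [T1 a1 b1]]] := h1 _ r4; have [c2 [k2 [T2 a2 b2]]] := h2 _ r4.
exists (fun i => c1 i - c2 i), (k1 - k2); split; first exact: hT.
  by apply: l2dist_le_weaken (l2dist_leB a1 a2); lra.
have -> : k1 - k2 - (h - h') = (k1 - h) + - (k2 - h').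
  by rewrite !opprB addrACA [RHS]addrACA; congr (_ + _); rewrite addrC.
by apply: le_lt_trans (sqnormD hH _ _) _; rewrite (sqnormN hH); lra.
Qed.

End ClosedOperators.

(** * The synthesis operator of a family: adjoint relation and resolvents *)

Section Synthesis.
Variables (R : realType) (H : lmodType R[i]) (ip : H -> H -> R[i]) (I : countType).
Variable phi : I -> H.
Hypothesis hH : hilbert_space ip.
Local Notation sqnorm := (sqnorm ip).
Local Notation D := (D_Psi ip phi).
Implicit Types (c : I -> R[i]) (f g h : H).

Lemma has_sum_ipP (a : I -> H) l : has_sum (fun x => ip x x) a l <->
  forall r : R, 0 < r -> exists s0 : seq I, forall s : seq I,
    uniq s -> {subset s0 <= s} -> sqnorm (\sum_(i <- s) a i - l) < r.
Proof. exact: (has_sumP (ip_sqnorm hH)). Qed.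

Lemma D_Psi_finite c (s : seq I) : uniq s ->
  (forall i, i \notin s -> c i = 0) -> D c (\sum_(i <- s) c i *: phi i).
Proof.
move=> us h; split; first exact: l2_finite us h.
apply: (has_sum_finite (ip_sqnorm hH)) => //; first exact: sqnorm0.
by move=> i /h ->; rewrite scale0r.
Qed.

Lemma D_PsiB c h c' h' : D c h -> D c' h' -> D (fun i => c i - c' i) (h - h').
Proof.
move=> [/l2P [M hM] s] [/l2P [M' hM'] s']; split.
  apply/l2P; exists (2 * (M + M')) => t ut.
  apply: (@le_trans _ _ (\sum_(i <- t) 2 * (sqmod (c i) + sqmod (c' i)))).
    by apply: ler_sum => i _; rewrite -[sqmod (c' i)]sqmodN; exact: sqmodD.
  by rewrite -mulr_sumr big_split /=; have := hM t ut; have := hM' t ut; lra.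
have := has_sumB (ip_sqnorm hH) (sqnormD hH) (sqnormN hH) s s'.
by congr has_sum; apply/funext => i; rewrite scalerBl.
Qed.

Lemma closure_D_l2 c h : op_closure ip D c h -> l2 c.
Proof. by apply: op_closure_l2 => // c' h' []. Qed.

Lemma closure_DB c h c' h' : op_closure ip D c h -> op_closure ip D c' h' ->
  op_closure ip D (fun i => c i - c' i) (h - h').
Proof. by apply: op_closureB => // *; exact: D_PsiB. Qed.

(** Continuity of the inner product gives the relation on the graph of [D], and Cauchy-Schwarz in H
    and in ℓ² carries it to the closure. It says that the closure of [D] is contained in the adjoint
    of the analysis map. *)
Lemma closure_D_adjoint c h g : op_closure ip D c h -> Cdom ip phi g ->
  has_sum (@csq _) (fun i => ip g (phi i) * ((c i)^*)%R) (ip g h).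
Proof.
move=> /(op_closureP hH) hc /l2P [M hM].
have M0 : 0 <= M by have := hM [::] isT; rewrite big_nil.
have g0 := sqnorm_ge0 hH g.
apply/(has_sumP (@csqE R)) => r r0.
(* Two uses of [sqmodD] bound the total error by [(8 * sqnorm g + 2 * M) * e]; the extra 1 makes the
   inequality strict. *)
pose e := r / (2 * M + 8 * sqnorm g + 1).
have D0 : 0 < 2 * M + 8 * sqnorm g + 1 by lra.
have e0 : 0 < e by rewrite divr_gt0.
have [c' [h' [[_ /has_sum_ipP hs] /l2dist_leP hd hh]]] := hc e e0.
have [s0 hs0] := hs e e0; exists s0 => s us ss.
have k1 := hs0 s us ss; have k2 := hd s us.
(* Three errors: the partial sum against [h'], [h'] against [h], and [c'] against [c]. *)
have -> : \sum_(i <- s) ip g (phi i) * ((c i)^*)%R - ip g h =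
  (ip g (\sum_(i <- s) c' i *: phi i - h') + ip g (h' - h)) +
  - \sum_(i <- s) ip g (phi i) * ((c' i - c i)^*)%R.
  rewrite (ipBr hH) (ip_sumr hH) (ipBr hH).
  under [X in _ = _ - X]eq_bigr do rewrite rmorphB mulrBr.
  under [X in _ = X - _ + _ + _]eq_bigr do rewrite (ipZr hH) mulrC.
  by rewrite sumrB; ring.
apply: le_lt_trans (sqmodD _ _) _; rewrite sqmodN.
have j1 := sqmodD (ip g (\sum_(i <- s) c' i *: phi i - h')) (ip g (h' - h)).
have j2 := ip_CauchySchwarz hH g (\sum_(i <- s) c' i *: phi i - h').
have j3 := ip_CauchySchwarz hH g (h' - h).
have j4 := sum_CauchySchwarz (fun i => ip g (phi i)) (fun i => c' i - c i) s.
have j5 : sqnorm g * sqnorm (\sum_(i <- s) c' i *: phi i - h') <= sqnorm g * e.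
  by rewrite ler_wpM2l // ltW.
have j6 : sqnorm g * sqnorm (h' - h) <= sqnorm g * e by rewrite ler_wpM2l // ltW.
have j7 : (\sum_(i <- s) sqmod (ip g (phi i))) *
   (\sum_(i <- s) sqmod (c' i - c i)) <= M * e.
  apply: ler_pM; [| |exact: hM|by []]; apply: sumr_ge0 => i _; exact: sqmod_ge0.
have -> : r = e * (2 * M + 8 * sqnorm g + 1) by rewrite /e divfK ?gt_eqF.
by move: j1 j2 j3 j4 j5 j6 j7 e0 => /=; lra.
Qed.

(* Adding one vector to the family is a rank-one update, solved by the Sherman-Morrison formula. *)
Lemma finite_resolvent (eps : R) (s : seq I) f : 0 < eps ->
  exists g, eps%:C *: g + \sum_(i <- s) ip g (phi i) *: phi i = f.
Proof.
move=> eps0; elim: s f => [|j s IH] f.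
  exists ((eps%:C)^-1 *: f); rewrite big_nil addr0 scalerA divff ?scale1r //.
  by rewrite fmorph_eq0 gt_eqF.
have [b hb] := IH (phi j); have [b' hb'] := IH f.
(* Pairing [b] with its own equation shows that [ip b (phi j)] is this nonnegative real, so the
   denominator [1 + r] does not vanish. *)
pose r := eps * sqnorm b + \sum_(i <- s) sqmod (ip b (phi i)).
have r0 : 0 <= r.
  apply: addr_ge0; first by rewrite mulr_ge0 ?sqnorm_ge0 // ltW.
  by apply: sumr_ge0 => i _; exact: sqmod_ge0.
have hr : ip b (phi j) = r%:C.
  rewrite -{1}hb (ipDr hH) (ipZr hH) (ip_sumr hH) conjCr (ip_sqnorm hH).
  rewrite rmorphD rmorphM rmorph_sum; congr (_ + _); apply: eq_bigr => i _.
  by rewrite (ipZr hH) mulrC mulJ_sqmod.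
have n0 : 1 + r%:C != 0 by rewrite -[1]/(1%:C) -rmorphD fmorph_eq0 gt_eqF //=; lra.
(* The coefficient of [phi j] must be the one that the corrected vector itself produces, a linear
   equation for [t]. *)
have [t tE] : exists t, ip (b' - t *: b) (phi j) = t.
  by exists (ip b' (phi j) / (1 + r%:C)); rewrite (ipBl hH) (ipZl hH) hr; field.
exists (b' - t *: b); rewrite big_cons tE.
transitivity (eps%:C *: b' + \sum_(i <- s) ip b' (phi i) *: phi i -
   t *: (eps%:C *: b + \sum_(i <- s) ip b (phi i) *: phi i) + t *: phi j).
  under eq_bigr do rewrite (ipBl hH) (ipZl hH) scalerBl -scalerA.
  rewrite sumrB -scaler_sumr scalerBr scalerDr !scalerA [t * _]mulrC.
  by rewrite opprD [in RHS]addrACA [t *: phi j + _]addrC !addrA.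
by rewrite hb hb' subrK.
Qed.

(* [g] is the limit of the resolvents of finite subfamilies, which converge because
   [E k = <f, g k>] is nonincreasing and its decrements are the squared distances. *)
Lemma resolvent (eps : R) f : 0 < eps -> exists g,
  op_closure ip D (fun i => ip g (phi i)) (f - eps%:C *: g).
Proof.
move=> eps0.
have /choice [g hg] := fun k => finite_resolvent (initial I k) f eps0.
pose c k i := if i \in initial I k then ip (g k) (phi i) else 0.
have cE k : \sum_(i <- initial I k) c k i *: phi i = f - eps%:C *: g k.
  rewrite -{1}(hg k) addrC addKr; apply: eq_big_seq => i hi.
  by rewrite /c hi.
have c0 k i : i \notin initial I k -> c k i = 0 by rewrite /c => /negbTE ->.
pose E k := Re (ip f (g k)).
(* Pair the equation of [g j] with [g k]; since [c j] vanishes outside [initial I j], the sum may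
   run over the larger set. *)
have EE j k : (j <= k)%N -> E k = eps * Re (ip (g j) (g k)) +
    \sum_(i <- initial I k) Re (c j i * ((c k i)^*)%R).
  move=> jk; rewrite /E -{1}(hg j) (ipDl hH) (ipZl hH) (ip_suml hH) raddfD /=.
  rewrite -Re_sum; congr (_ + Re _); first by case: (ip _ _) => a b /=; ring.
  rewrite -(sum_mem_subset _ (initial_uniq I j) (initial_uniq I k) (sub_initial jk)).
  apply: eq_big_seq => i hi; rewrite /c hi; case: ifP => _; rewrite ?mul0r //.
  by rewrite (ipZl hH) -(ipJ hH).
have EJ j k : (j <= k)%N -> E j = eps * sqnorm (g j) +
    \sum_(i <- initial I k) sqmod (c j i).
  move=> jk; rewrite (EE j j) //; congr (_ + _).
  rewrite -(sum_mem_subset _ (initial_uniq I j) (initial_uniq I k) (sub_initial jk)).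
  apply: eq_bigr => i _; case: ifP => h; first by rewrite mulJ_sqmod.
  by rewrite c0 ?sqmod0 // h.
(* Write the left side as [E j + E k - 2 * E k]: [EJ] gives the two squares and [EE] the cross
   term. *)
have Ediff j k : (j <= k)%N -> E j - E k = eps * sqnorm (g j - g k) +
    \sum_(i <- initial I k) sqmod (c j i - c k i).
  move=> jk; rewrite (sqnormB_expand hH).
  under eq_bigr do rewrite sqmodB_expand.
  rewrite sumrB big_split /= -mulr_sumr.
  by have := EE j k jk; have := EJ j k jk; have := EJ k k (leqnn _); lra.
have S0 (a : I -> R[i]) s : 0 <= \sum_(i <- s) sqmod (a i).
  by apply: sumr_ge0 => i _; exact: sqmod_ge0.
have E0 k : 0 <= E k.
  by rewrite (EJ k k) // addr_ge0 // mulr_ge0 ?sqnorm_ge0 // ltW.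
have Emono j k : (j <= k)%N -> E k <= E j.
  move=> jk; rewrite -subr_ge0 Ediff // addr_ge0 // ?mulr_ge0 ?sqnorm_ge0 // ?ltW //.
have ECauchy := nonincreasing_Cauchy E0 Emono.
have [l hl] : exists l, hconv ip g l.
  apply: (hilbert_complete hH) => r r0.
  have [|N hN] := ECauchy (eps * (r / 4)); first by rewrite mulr_gt0 //; lra.
  have close k : (N <= k)%N -> sqnorm (g N - g k) < r / 4.
    move=> Nk; rewrite -(ltr_pM2l eps0); apply: le_lt_trans (hN k Nk).
    by rewrite Ediff // lerDl.
  exists N => m n /close hm /close hn.
  have -> : g m - g n = (g m - g N) + (g N - g n) by rewrite addrA subrK.
  by apply: le_lt_trans (sqnormD hH _ _) _; rewrite (sqnormBC hH (g m)); lra.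
exists l, c, (fun k => f - eps%:C *: g k); split.
  by move=> k; rewrite -cE; apply: D_Psi_finite (c0 k); exact: initial_uniq.
split.
  apply: l2conv_of_Cauchy => [r r0|i r r0].
    have [|N hN] := ECauchy (r / 4); first by lra.
    have close k : (N <= k)%N -> l2dist_le (c N) (c k) (r / 4)%:C.
      move=> Nk; apply/l2dist_leP => s us; apply: le_trans (ltW (hN k Nk)).
      rewrite Ediff //; apply: le_trans (_ : _ <= \sum_(i <- initial I k) sqmod (c N i - c k i)) _.
        apply: ler_sum_support => // [|i|i hi]; [exact: initial_uniq|exact: sqmod_ge0|].
        rewrite !c0 ?subrr ?sqmod0 //; apply: contra hi; exact: sub_initial.
      by rewrite lerDr mulr_ge0 ?sqnorm_ge0 // ltW.
    exists N => m n /close hm /close hn.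
    by apply: l2dist_le_weaken (l2dist_le_trans (l2dist_leC hm) hn); lra.
  have [N hN] := ip_hconv hH (phi i) hl r0.
  (* Past the code of [i], the truncated coefficient [c n i] is the true [ip (g n) (phi i)]. *)
  exists (maxn N (pickle i).+1) => n; rewrite geq_max => /andP[Nn ni].
  by rewrite /c mem_initial ni hN.
apply/(hconvP hH) => r r0; move/(hconvP hH): hl => hl.
have [|N hN] := hl (r / eps ^+ 2); first by rewrite divr_gt0 // exprn_gt0.
exists N => n /hN; rewrite ltr_pdivlMr ?exprn_gt0 // mulrC -sqmodr -(sqnormZ hH).
rewrite scalerBr (sqnormBC hH); congr (sqnorm _ < r).
by rewrite [RHS]addrC opprB addrA subrK.
Qed.

End Synthesis.

(** * Closures of subspaces *)

Section ClosureOfSubspace.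
Variables (R : realType) (H : lmodType R[i]) (ip : H -> H -> R[i]).
Hypothesis hH : hilbert_space ip.
Variable S : H -> Prop.
Local Notation sqnorm := (sqnorm ip).

Lemma sub_hclosure x : S x -> hclosure ip S x.
Proof.
by move=> Sx; apply/(hclosureP hH) => r r0; exists x; rewrite subrr sqnorm0.
Qed.

Lemma hclosure_idem x : hclosure ip (hclosure ip S) x -> hclosure ip S x.
Proof.
move=> /(hclosureP hH) h; apply/(hclosureP hH) => r r0.
have [|y [/(hclosureP hH) hy xy]] := h (r / 4); first by lra.
have [|z [Sz yz]] := hy (r / 4); first by lra.
exists z; split=> //; have -> : x - z = (x - y) + (y - z) by rewrite addrA subrK.
by apply: le_lt_trans (sqnormD hH _ _) _; lra.
Qed.

Hypothesis S_lin : forall a x y, S x -> S y -> S (a *: x + y).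

Lemma hclosure_lin a x y :
  hclosure ip S x -> hclosure ip S y -> hclosure ip S (a *: x + y).
Proof.
move=> /(hclosureP hH) hx /(hclosureP hH) hy; apply/(hclosureP hH) => r r0.
have a0 := sqmod_ge0 a; have p0 : 0 < 4 * (sqmod a + 1) by lra.
have [|x' [Sx' xx']] := hx (r / (4 * (sqmod a + 1))); first by rewrite divr_gt0.
have [|y' [Sy' yy']] := hy (r / 4); first by lra.
exists (a *: x' + y'); split; first exact: S_lin.
have -> : a *: x + y - (a *: x' + y') = a *: (x - x') + (y - y').
  by rewrite scalerBr opprD addrACA.
apply: le_lt_trans (sqnormD hH _ _) _; rewrite (sqnormZ hH).
have := sqnorm_ge0 hH (x - x').
by move: xx'; rewrite ltr_pdivlMr // => h1 h2; nra.
Qed.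

End ClosureOfSubspace.

(** * Range of the closed synthesis operator *)

Section SynthesisRange.
Variables (R : realType) (H : lmodType R[i]) (ip : H -> H -> R[i]).
Hypothesis hH : hilbert_space ip.
Variables (I : countType) (phi : I -> H) (S : H -> Prop).
Hypothesis S0 : S 0.
Hypothesis S_lin : forall a x y, S x -> S y -> S (a *: x + y).

(** Finite combinations lie in [S], values of the synthesis operator in its closure, and their
    limits in the closure of that closure. *)
Lemma closure_D_range c h : (forall i, S (phi i)) ->
  op_closure ip (D_Psi ip phi) c h -> hclosure ip S h.
Proof.
move=> Sphi /(op_closureP hH) hc; apply: (hclosure_idem hH).
apply/(hclosureP hH) => r r0; have [c' [h' [[_ hs] _ hh]]] := hc r r0.
exists h'; split; last by rewrite sqnormBC.
apply/(hclosureP hH) => e /((has_sum_ipP hH _ _).1 hs) [s0 hs0].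
exists (\sum_(i <- undup s0) c' i *: phi i); split; last first.
  by rewrite (sqnormBC hH) hs0 ?undup_uniq // => i; rewrite mem_undup.
by elim/big_rec: _ => // i x _ Sx; exact: S_lin.
Qed.

End SynthesisRange.

(** * The closed operator [T] of the projected family *)

Section LowerFrameSequence.
Variables (R : realType) (H : lmodType R[i]) (ip : H -> H -> R[i]).
Variables (I : countType) (psi : I -> H) (P : H -> H).
Hypothesis hH : hilbert_space ip.
Hypothesis hP : orth_proj ip (HPsi ip psi) P.
Local Notation sqnorm := (sqnorm ip).
Local Notation M := (HPsi ip psi).
Local Notation phi := (fun i => P (psi i)).
Local Notation T := (op_closure ip (Dr_Psi ip psi P)).

Lemma Cdom_lin a f g :
  Cdom ip psi f -> Cdom ip psi g -> Cdom ip psi (a *: f + g).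
Proof.
move=> hf hg; rewrite /Cdom; have := l2_lin a hf hg; congr l2.
by apply/funext => i; rewrite (ipDl hH) (ipZl hH).
Qed.

Lemma HPsi_lin a f g : M f -> M g -> M (a *: f + g).
Proof. exact/hclosure_lin/Cdom_lin. Qed.

Lemma Cdom_HPsi f : Cdom ip psi f -> M f.
Proof. exact: sub_hclosure. Qed.

Lemma HPsi0 : M 0.
Proof.
apply: Cdom_HPsi; apply/l2P; exists 0 => s _.
by rewrite big1 // => i _; rewrite (ip0l hH) sqmod0.
Qed.

Lemma HPsiB f g : M f -> M g -> M (f - g).
Proof. by move=> Mf Mg; rewrite addrC -scaleN1r; exact: HPsi_lin. Qed.

Lemma ip_proj f x : M f -> ip f (P x) = ip f x.
Proof.
move=> Mf; have [_ /(_ f Mf) h] := hP x; apply/eqP; rewrite eq_sym -subr_eq0.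
by rewrite -(ipBr hH) (ipJ hH) // h rmorph0.
Qed.

Lemma analysis_proj f : M f -> (fun i => ip f (phi i)) = (fun i => ip f (psi i)).
Proof. by move=> Mf; apply/funext => i; exact: ip_proj. Qed.

(** [Dr_Psi ip psi P] is convertible to [D_Psi] of the projected family, whose members lie in the
    closed subspace [M]. *)
Lemma synthesis_range c h : T c h -> M h.
Proof.
move=> hT; apply: (hclosure_idem hH).
apply: (closure_D_range hH HPsi0 HPsi_lin _ hT) => i.
by have [] := hP (psi i).
Qed.

(** This is [closure_D_adjoint] for the projected family; on [M] the analysis coefficients do not
    see the projection. *)
Lemma synthesis_adjoint c h g : T c h -> Cdom ip psi g ->
  has_sum (@csq _) (fun i => ip g (psi i) * ((c i)^*)%R) (ip g h).
Proof.
move=> hT hg; have e := analysis_proj (Cdom_HPsi hg).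
have := closure_D_adjoint hH hT (g := g); rewrite /Cdom e => /(_ hg).
congr has_sum; apply/funext => i.
by rewrite ip_proj //; exact: Cdom_HPsi.
Qed.

(** Closability of D^r: two values over [c] differ by a value over 0, which is orthogonal to
    D(C_Psi) by the adjoint relation and lies in its closure. *)
Lemma synthesis_functional c h h' : T c h -> T c h' -> h = h'.
Proof.
move=> h1 h2; have h3 := closure_DB hH h1 h2; apply/eqP; rewrite -subr_eq0.
apply/eqP/(hclosure_orth hH) => [|g hg]; first exact: synthesis_range h3.
apply: (csq_has_sum_unique (synthesis_adjoint h3 hg)).
suff -> : (fun i => ip g (psi i) * ((c i - c i)^*)%R) = fun=> 0.
  by have := has_sum_finite (a := fun=> 0) (@csqE R) (@sqmod0 R) (isT : uniq (Nil I));
     rewrite big_nil; apply.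
by apply/funext => i; rewrite subrr rmorph0 mulr0.
Qed.

(** * Solving the frame equation under the lower bound *)

Hypothesis hA : lower_frame_seq ip psi.

Lemma lower_bound_real : exists2 A : R, 0 < A & forall f (z : R),
  Cdom ip psi f ->
  (forall s : seq I, uniq s -> \sum_(i <- s) sqmod (ip f (psi i)) <= z) ->
  A * sqnorm f <= z.
Proof.
have [_ [/RealC_gt0 [A A0 ->] h]] := hA; exists A => // f z hf hz.
have := h f hf z%:C; rewrite (ip_sqnorm hH) -rmorphM lecR; apply=> s us.
by rewrite csq_sumE lecR hz.
Qed.

(** From |h - A u|^2 >= 0 follows |h|^2 >= 2 A Re <u, h> - A^2 |u|^2 >= A^2 |u|^2. *)
Lemma le_sqnorm_of_coercive (A : R) u h : 0 < A ->
  A * sqnorm u <= Re (ip u h) -> A ^+ 2 * sqnorm u <= sqnorm h.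
Proof.
move=> A0 hu; have := sqnorm_ge0 hH (h - A%:C *: u).
rewrite (sqnormB_expand hH) (sqnormZ hH) sqmodr (ipZr hH) conjCr (ipJ hH) //.
have -> : Re (A%:C * ((ip u h)^*)%R) = A * Re (ip u h).
  by case: (ip u h) => a b /=; ring.
by nra.
Qed.

(** Resolvents at 1/(n+1) solve the equation up to a multiple of [g n]. Coercivity bounds [g n], so
    this defect vanishes in the limit; applied to differences, it makes [g n] and their coefficients
    Cauchy, and closedness of [T] finishes. *)
Lemma frame_operator_onto f : M f ->
  exists2 g, Cdom ip psi g & T (fun i => ip g (psi i)) f.
Proof.
move=> Mf; have [A A0 hlow] := lower_bound_real.
have eps0 n : 0 < n.+1%:R^-1 :> R by rewrite invr_gt0 ltr0Sn.
have eps1 n : n.+1%:R^-1 <= 1 :> R by rewrite invf_le1 ?ltr0Sn // ler1n.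
have /choice [g hg] := fun n => resolvent phi hH f (eps0 n).
pose h n := f - n.+1%:R^-1%:C *: g n.
(* A nonzero multiple of [g n] is the difference of [f] and [h n], both in [M]. *)
have Mg n : M (g n).
  have := HPsiB Mf (synthesis_range (hg n)).
  rewrite opprB addrC subrK => Me.
  have := HPsi_lin (n.+1%:R^-1%:C)^-1 Me HPsi0.
  by rewrite addr0 scalerA mulVf ?scale1r // fmorph_eq0 gt_eqF.
have hT n : T (fun i => ip (g n) (psi i)) (h n) by rewrite -analysis_proj.
have Cg n : Cdom ip psi (g n) := closure_D_l2 hH (hT n).
have coercive u k : Cdom ip psi u -> T (fun i => ip u (psi i)) k ->
  (forall s : seq I, uniq s -> \sum_(i <- s) sqmod (ip u (psi i)) <= Re (ip u k)) /\
  A * sqnorm u <= Re (ip u k).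
  move=> Cu Tu; have hs := l2ip_ge_partial (synthesis_adjoint Tu Cu).
  by split=> //; exact: hlow.
(* The defect contributes a nonpositive term to Re <g n, h n>, so [le_sqnorm_of_coercive] applies
   with [f] in place of [h n]. *)
pose K := sqnorm f / A ^+ 2.
have K0 : 0 <= K by rewrite divr_ge0 ?sqnorm_ge0 // exprn_ge0 // ltW.
have gK n : sqnorm (g n) <= K.
  rewrite ler_pdivlMr ?exprn_gt0 // mulrC; apply: le_sqnorm_of_coercive => //.
  have [_] := coercive _ _ (Cg n) (hT n); rewrite /h (ipBr hH) (ipZr hH) conjCr (ip_sqnorm hH).
  rewrite -rmorphM raddfB /= => hle; apply: le_trans hle _; rewrite gerDl oppr_le0.
  by rewrite mulr_ge0 ?sqnorm_ge0 // ltW.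
(* Squaring the scalar is harmless because it is at most 1. *)
have gB n : sqnorm (n.+1%:R^-1%:C *: g n) <= n.+1%:R^-1 * K.
  rewrite (sqnormZ hH) sqmodr; apply: ler_pM; rewrite ?sqr_ge0 ?sqnorm_ge0 //.
  by rewrite expr2 ler_piMr // ltW.
have hB m n : sqnorm (h m - h n) <= 2 * (m.+1%:R^-1 * K + n.+1%:R^-1 * K).
  have -> : h m - h n = n.+1%:R^-1%:C *: g n + - (m.+1%:R^-1%:C *: g m).
    by rewrite /h [LHS]addrC opprB addrA subrK.
  apply: le_trans (sqnormD hH _ _) _; rewrite (sqnormN hH).
  by rewrite ler_wpM2l // addrC lerD.
have hsmall r : 0 < r -> exists N, forall m n, (N <= m)%N -> (N <= n)%N ->
    sqnorm (h m - h n) < r.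
  (* With scalars below [r / (4 * (K + 1))], [hB] gives at most r K / (K + 1), which is below
     [r]. *)
  move=> r0; have p0 : 0 < 4 * (K + 1) by lra.
  have [|N hN] := @invS_lt R (r / (4 * (K + 1))); first by rewrite divr_gt0.
  exists N => m n /hN hm /hN hn; apply: le_lt_trans (hB m n) _.
  move: hm hn; rewrite !ltr_pdivlMr //; have := eps0 m; have := eps0 n.
  by move: K0; clear; move: (m.+1%:R^-1) (n.+1%:R^-1) => a b *; nra.
have diff m n : (forall s : seq I, uniq s ->
      \sum_(i <- s) sqmod (ip (g m) (psi i) - ip (g n) (psi i)) <= sqnorm (h m - h n) / A) /\
    sqnorm (g m - g n) <= sqnorm (h m - h n) / A ^+ 2.
  have E : (fun i => ip (g m) (psi i) - ip (g n) (psi i)) =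
           (fun i => ip (g m - g n) (psi i)).
    by apply/funext => i; rewrite (ipBl hH).
  have Tu : T (fun i => ip (g m - g n) (psi i)) (h m - h n).
    by rewrite -E; exact: (closure_DB hH (hT m) (hT n)).
  have Cu : Cdom ip psi (g m - g n) := closure_D_l2 hH Tu.
  have [h1 h2] := coercive _ _ Cu Tu; have h3 := le_sqnorm_of_coercive A0 h2.
  split; last by rewrite ler_pdivlMr ?exprn_gt0 // mulrC.
  move=> s us; under eq_bigr do rewrite -(ipBl hH).
  apply: le_trans (h1 s us) _; rewrite ler_pdivlMr //.
  (* For u = g m - g n and k = h m - h n, expanding |k - A u|^2 >= 0 and using A |u|^2 <= Re <u, k>
     yields A Re <u, k> <= |k|^2. *)
  have := sqnorm_ge0 hH (h m - h n - A%:C *: (g m - g n)).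
  rewrite [X in _ <= X -> _](sqnormB_expand hH) (sqnormZ hH) sqmodr (ipZr hH) conjCr.
  rewrite [ip (h m - h n) _](ipJ hH) //.
  have -> : Re (A%:C * ((ip (g m - g n) (h m - h n))^*)%R) =
    A * Re (ip (g m - g n) (h m - h n)).
    by case: (ip (g m - g n) (h m - h n)) => a b /=; ring.
  by move: h2 A0; clear; nra.
have [l hl] : exists l, hconv ip g l.
  apply: (hilbert_complete hH) => r r0.
  have [|N hN] := hsmall (r * A ^+ 2); first by rewrite mulr_gt0 ?exprn_gt0.
  exists N => m n Nm Nn; apply: le_lt_trans (diff m n).2 _.
  by rewrite ltr_pdivrMr ?exprn_gt0 // hN.
have cl : l2conv (fun n i => ip (g n) (psi i)) (fun i => ip l (psi i)).
  apply: l2conv_of_Cauchy => [r r0|i]; last exact: ip_hconv.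
  have [|N hN] := hsmall (r * A); first by rewrite mulr_gt0.
  exists N => m n Nm Nn; apply/l2dist_leP => s us.
  apply: le_trans ((diff m n).1 s us) _.
  by rewrite ler_pdivrMr // ltW // hN.
have Tl : T (fun i => ip l (psi i)) f.
  apply: (op_closure_closed hH) => r r0.
  have [|N1 h1] := cl r%:C; first by rewrite ltcR.
  have [|N2 h2] := @invS_lt R (r / (K + 1)); first by rewrite divr_gt0 //; lra.
  pose n := maxn N1 N2; exists (fun i => ip (g n) (psi i)), (h n); split=> //.
    by apply: h1; exact: leq_maxl.
  rewrite /h addrAC subrr sub0r (sqnormN hH); apply: le_lt_trans (gB n) _.
  have := h2 n (leq_maxr _ _); have := eps0 n.
  rewrite ltr_pdivlMr; last by lra.
  by move: (n.+1%:R^-1) => a *; nra.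
by exists l => //; exact: (closure_D_l2 hH Tl).
Qed.

(** * The canonical dual and the pseudo-inverse conditions *)

Variable psit : I -> H.
Hypothesis hpsit : forall i, Gamma_Psi ip psi (psit i) (P (psi i)).

(** Both sides equal the ℓ² inner product of the coefficients of [g] and of [psit i]: test
    [Gamma_Psi] at [psit i] against [g], and [T] at the coefficients of [g] against [psit i]. *)
Lemma dual_analysis g f i : Cdom ip psi g -> T (fun i => ip g (psi i)) f ->
  ip f (psit i) = ip g (psi i).
Proof.
move=> Cg Tg; have [Cpsit [_ [_ /(_ g Cg)]]] := hpsit i.
rewrite ip_proj; last exact: Cdom_HPsi.
move=> h1; have /has_sum_conj := synthesis_adjoint Tg Cpsit.
rewrite -(ipJ hH) // => h2; apply: csq_has_sum_unique h2 _.
move: h1; congr has_sum; apply/funext => j.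
by rewrite rmorphM /= conjCK mulrC.
Qed.

Lemma dual_analysisP f : M f -> exists g,
  [/\ Cdom ip psi g, (fun i => ip f (psit i)) = (fun i => ip g (psi i)) &
      T (fun i => ip f (psit i)) f].
Proof.
move=> /frame_operator_onto [g Cg Tg]; exists g.
have E : (fun i => ip f (psit i)) = (fun i => ip g (psi i)).
  by apply/funext => i; exact: dual_analysis.
by rewrite E.
Qed.

(** By the adjoint relation, analysis coefficients are orthogonal to every [d] with [T d 0];
    Cauchy-Schwarz with a bound [B] on |d|^2 extends this to limits. *)
Lemma orth_ker_of_approx (c d : I -> R[i]) :
  (forall e : R[i], 0 < e -> exists f c',
     (M f /\ c' = (fun i => ip f (psit i))) /\ l2dist_le c c' e) ->
  T d 0 -> l2ip c d 0.
Proof.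
move=> hc Td; have /l2P [B hB] := closure_D_l2 hH Td.
have B0 : 0 <= B by have := hB [::] isT; rewrite big_nil.
apply/(has_sumP (@csqE R)) => r r0.
have p0 : 0 < 4 * (B + 1) by lra.
have [|f [_ [[/dual_analysisP [g [Cg -> _]] ->] /l2dist_leP hd]]] :=
  hc (r / (4 * (B + 1)))%:C; first by rewrite ltcR divr_gt0.
have := synthesis_adjoint Td Cg; rewrite (ip0r hH) => /(has_sumP (@csqE R)) hs.
have [|s0 hs0] := hs (r / 4); first by lra.
exists s0 => s us ss; have := hs0 s us ss; rewrite !subr0 => h1.
have -> : \sum_(i <- s) c i * ((d i)^*)%R =
   \sum_(i <- s) (c i - ip g (psi i)) * ((d i)^*)%R +
   \sum_(i <- s) ip g (psi i) * ((d i)^*)%R.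
  by rewrite -big_split; apply: eq_bigr => i _; rewrite /= -mulrDl subrK.
apply: le_lt_trans (sqmodD _ _) _.
have h2 := sum_CauchySchwarz (fun i => c i - ip g (psi i)) d s.
have : (\sum_(i <- s) sqmod (c i - ip g (psi i))) * (\sum_(i <- s) sqmod (d i)) <=
   r / (4 * (B + 1)) * B.
  by apply: ler_pM; [| |exact: hd|exact: hB]; apply: sumr_ge0 => i _; exact: sqmod_ge0.
have : r / (4 * (B + 1)) * B <= r / 4.
  rewrite mulrAC ler_pdivrMr //; nra.
by move: h1 h2 => /=; lra.
Qed.

(* With [c'] a truncation of [c] and [Dc' = f], the sequence [d = c' - Cg] is the projection
   of [c'] onto the kernel; as [c] is orthogonal to the kernel, [|d| <= |c - c'|]. *)
Lemma approx_of_orth_ker (c : I -> R[i]) : l2 c ->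
  (forall d, T d 0 -> l2ip c d 0) ->
  forall e : R[i], 0 < e -> exists f c',
     (M f /\ c' = (fun i => ip f (psit i))) /\ l2dist_le c c' e.
Proof.
move=> l2c hc e /RealC_gt0 [r r0 ->]; have r4 : 0 < r / 4 by lra.
have [N hN] := l2_truncation l2c r4.
set c1 := (fun i => if _ then _ else _) in hN.
pose f := \sum_(i <- initial I N) c1 i *: P (psi i).
have Tc1 : T c1 f.
  apply/(op_closureP hH) => q q0; exists c1, f; split.
  - apply: D_Psi_finite => // [|i hi]; first exact: initial_uniq.
    by rewrite /c1 (negbTE hi).
  - by apply/l2dist_leP => s _; rewrite big1 ?ltW // => i _; rewrite subrr sqmod0.
  - by rewrite subrr sqnorm0.
have Mf := synthesis_range Tc1.
have [g [Cg E Tf]] := dual_analysisP Mf.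
exists f, (fun i => ip f (psit i)); split=> //.
pose d i := c1 i - ip f (psit i).
have Td : T d 0 by rewrite -(subrr f); exact: (closure_DB hH Tc1 Tf).
have hd : forall s : seq I, uniq s -> \sum_(i <- s) sqmod (d i) <= r / 4.
  apply: (@orthogonal_contraction _ _ (fun i => c i - c1 i)).
    by apply/l2dist_leP.
  (* Both [c] and the coefficients of [g] are orthogonal to [d], and their difference is
     [(c - c1) + d]. *)
  have := csq_has_sumB (hc d Td) (synthesis_adjoint Td Cg).
  rewrite (ip0r hH) subr0; congr has_sum; apply/funext => i.
  have -> : ip g (psi i) = ip f (psit i) by have := congr1 (fun u => u i) E.
  by rewrite -mulrBl /d addrA subrK.
apply: (@l2dist_le_weaken _ _ _ _ (2 * (r / 4 + r / 4))); first by lra.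
apply: l2dist_le_trans hN _.
by apply/l2dist_leP => s us; exact: hd.
Qed.

(** By [dual_analysisP], [T] inverts the candidate from the left on [M], so [T] has range [M]. Hence
    the kernel of the candidate and the complement of the range in [M] are both zero, and
    [T S T = T] follows since [T] is functional. *)
Lemma pseudo_inverse_synthesis : pseudo_inverse ip M T
  (fun f c => M f /\ c = (fun i => ip f (psit i))).
Proof.
split.
- move=> f c [Mf ->]; split=> //.
  by have [g [_ _ /(closure_D_l2 hH)]] := dual_analysisP Mf.
- split=> [f c1 c2 [_ ->] [_ ->] //|a f1 f2 c1 c2 [M1 ->] [M2 ->]].
  split; first exact: HPsi_lin.
  by apply/funext => i; rewrite (ipDl hH) (ipZl hH).
- move=> c l2c; split; first by move=> hc d; exact: orth_ker_of_approx.
  exact: approx_of_orth_ker.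
- move=> f; split=> [[Mf E]|[Mf h]]; split=> //.
    (* Zero coefficients give [T 0 f]; subtracting this point of the graph from itself gives
       [T 0 0], so [f = 0]. *)
    move=> c h _; have [g [_ _]] := dual_analysisP Mf; rewrite -E => Tf.
    suff -> : f = 0 by rewrite (ip0l hH).
    apply: (synthesis_functional Tf).
    by have /= := closure_DB hH Tf Tf; rewrite !subrr.
  have [g [_ _ Tf]] := dual_analysisP Mf.
  have -> : f = 0 by apply: (sqnorm_eq0 hH); rewrite /sqnorm (h _ _ Tf).
  by apply/funext => i; rewrite (ip0l hH).
- move=> c h; split=> [Tc|[h' [c' [Tc [Mh' ->] Tc']]]].
    have Mh := synthesis_range Tc; have [g [_ _ Th]] := dual_analysisP Mh.
    by exists h, (fun i => ip h (psit i)).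
  have [g [_ _ Th']] := dual_analysisP Mh'.
  by rewrite (synthesis_functional Tc' Th').
Qed.

End LowerFrameSequence.

(* If [f] is orthogonal to [D(C_Psi)], the resolvent at [1] sends [f] to [0], so
   [(0, f)] lies in the closure of the graph of [D_Psi]. *)
Lemma closable_HPsi (R : realType) (H : lmodType R[i]) (ip : H -> H -> R[i])
    (I : countType) (psi : I -> H) (P : H -> H) :
  hilbert_space ip -> orth_proj ip (HPsi ip psi) P ->
  closable ip (D_Psi ip psi) -> forall x, P x = x.
Proof.
move=> hH hP hcl x; have [_ hx] := hP x.
apply/esym/eqP; rewrite -subr_eq0; apply/eqP.
have [g hg] := resolvent psi hH (x - P x) (ltr01 : 0 < 1 :> R).
have Cg : Cdom ip psi g := closure_D_l2 hH hg.
(* The empty partial sum already gives 0 <= Re <g, x - P x - g>, and this equals -|g|^2 because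
   [x - P x] is orthogonal to D(C_Psi). *)
have g0 : g = 0.
  apply: (sqnorm_eq0 hH).
  have := l2ip_ge_partial (closure_D_adjoint hH hg Cg) (isT : uniq (Nil I)).
  rewrite big_nil (ipBr hH) scale1r (ipJ hH) // (hx g); last exact: Cdom_HPsi.
  rewrite rmorph0 sub0r raddfN /= -/(sqnorm ip g).
  by have := sqnorm_ge0 hH g; lra.
move: hg; rewrite g0 scaler0 subr0 => hg; apply: hcl hg _.
apply/(op_closureP hH) => r r0; exists (fun i => ip 0 (psi i)), 0; split.
- have := D_Psi_finite psi hH (isT : uniq (Nil I)) (c := fun i => ip 0 (psi i)).
  by rewrite big_nil; apply=> i _; rewrite (ip0l hH).
- by apply/l2dist_leP => s _; rewrite big1 ?ltW // => i _; rewrite subrr sqmod0.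
- by rewrite subrr sqnorm0.
Qed.

Theorem theorem6p14 (R : realType) (H : lmodType R[i]) (ip : H -> H -> R[i])
    (I : countType) (psi : I -> H) (P : H -> H) (psit : I -> H) :
  hilbert_space ip -> separable ip ->
  lower_frame_seq ip psi ->
  orth_proj ip (HPsi ip psi) P ->
  (forall i, Gamma_Psi ip psi (psit i) (P (psi i))) ->
  pseudo_inverse ip (HPsi ip psi) (op_closure ip (Dr_Psi ip psi P))
    (fun f c => HPsi ip psi f /\ c = (fun i => ip f (psit i))) /\
  (closable ip (D_Psi ip psi) ->
   pseudo_inverse ip (fun _ => True) (op_closure ip (D_Psi ip psi))
    (fun f c => c = (fun i => ip f (psit i)))).
Proof.
move=> hH _ hA hP hpsit.
have main := pseudo_inverse_synthesis hH hP hA hpsit; split=> // hcl.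
(* Once [P] is the identity, the subspace, the operator and the candidate all rewrite to those of
   the second claim. *)
have Pid := closable_HPsi hH hP hcl.
have MT f : HPsi ip psi f by rewrite -(Pid f); have [] := hP f.
have ED : Dr_Psi ip psi P = D_Psi ip psi.
  by have -> : P = id by exact/funext.
have EM : HPsi ip psi = fun=> True by apply/funext => f; apply/propext; split.
have ES : (fun f c => HPsi ip psi f /\ c = (fun i => ip f (psit i))) =
          (fun f c => c = (fun i => ip f (psit i))).
  by apply/funext => f; apply/funext => c; apply/propext; split=> [[]|].
by move: main; rewrite ES ED EM.
Qed.
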